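(* Let $\mathbb{T}$ be a time scale, $a,b\in\mathbb{T}$ with $a<b$, $I=[a,b]_{\mathbb{T}}$, let $g:I\to\mathbb{R}$ be strictly increasing, and let $\Box\in\{\Delta,\nabla\}$. Let $f:I\to\mathbb{R}$ be bounded. Then $f\in\mathcal{R}_{\Box}(g,I)$ if and only if for every $\varepsilon>0$ there exists a partition $P\in\mathcal{P}(I)$ such that $$U_{\Box}(P,f,g)-L_{\Box}(P,f,g)<\varepsilon .$$
   Context: A time scale $\mathbb{T}$ is a nonempty closed subset of $\mathbb{R}$. The jump operators are $\sigma(t)=\inf\{s\in\mathbb{T}: s>t\}$ and $\rho(t)=\sup\{s\in\mathbb{T}: s<t\}$ (with $\sigma(\max\mathbb{T})=\max\mathbb{T}$, $\rho(\min\mathbb{T})=\min\mathbb{T}$ when these exist). For $a<b$ in $\mathbb{T}$: $[a,b]_{\mathbb{T}}=[a,b]\cap\mathbb{T}$, $[a,b]_{\Delta}=[a,\rho(b)]_{\mathbb{T}}$, $[a,b]_{\nabla}=[\sigma(a),b]_{\mathbb{T}}$. The symbol $\Box$ stands for $\Delta$ or $\nabla$, the same choice throughout. $\mathcal{P}(I)$ is the set of partitions of $I=[a,b]_{\mathbb{T}}$, i.e. finite sets $P=\{t_0,\ldots,t_n\}\subset I$ with $a=t_0<\cdots<t_n=b$. For $P\in\mathcal{P}(I)$ put $\Delta g_j=g(t_j)-g(t_{j-1})$, $I_{\Box j}=[t_{j-1},t_j]_{\Box}$, $m_{\Box j}=\inf_{I_{\Box j}}f$, $M_{\Box j}=\sup_{I_{\Box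 j}}f$, and $$U_{\Box}(P,f,g)=\sum_{j=1}^n M_{\Box j}\Delta g_j,\qquad L_{\Box}(P,f,g)=\sum_{j=1}^n m_{\Box j}\Delta g_j .$$ The upper and lower Darboux-Stieltjes $\Box$-integrals are $\overline{\int_a^b}f\,\Box g=\inf_{P\in\mathcal{P}(I)}U_{\Box}(P,f,g)$ and $\underline{\int_a^b}f\,\Box g=\sup_{P\in\mathcal{P}(I)}L_{\Box}(P,f,g)$. If they are equal, $f$ is called Riemann-Stieltjes $\Box$-integrable with respect to $g$ on $I$, the common value is denoted $\int_a^b f\,\Box g$, and $\mathcal{R}_{\Box}(g,I)$ is the set of all such (bounded) $f$. *)

(* Defs.v *)
(* Real analysis over an abstract [R : realType] (MathComp-Analysis). *)
From HB Require Import structures.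
From mathcomp Require Import all_boot all_order all_algebra.
From mathcomp Require Import all_classical all_reals all_analysis.
Import Order.TTheory GRing.Theory Num.Theory.
Import numFieldNormedType.Exports.

Set Implicit Arguments.
Unset Strict Implicit.
Unset Printing Implicit Defensive.

Local Open Scope classical_set_scope.
Local Open Scope ring_scope.

Definition time_scale (R : realType) (T : set R) : Prop :=
  closed T /\ T !=set0.

(* The case distinctions implement [sigma (max T) = max T] and
   [rho (min T) = min T]; [inf] and [sup] of the empty set are [0] in the
   library. *)
Definition fwd_jump (R : realType) (T : set R) (t : R) : R :=
  let S := [set s | T s /\ t < s] in if pselect (S !=set0) then inf S else t.

Definition bwd_jump (R : realType) (T : set R) (t : R) : R :=
  let S := [set s | T s /\ s < t] in if pselect (S !=set0) then sup S else t.

Definition ts_itv (R : realType) (T : set R) (a b : R) : set R :=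
  `[a, b] `&` T.

Inductive box := Delta | Nabla.

Definition box_itv (bx : box) (R : realType) (T : set R) (a b : R) : set R :=
  match bx with
  | Delta => ts_itv T a (bwd_jump T b)
  | Nabla => ts_itv T (fwd_jump T a) b
  end.

(* As in the library's [itv_partition] and [variation], the partition
   [a = t_0 < ... < t_n = b] is encoded by [s = [:: t_1; ...; t_n]], and
   [t_j = nth b (a :: s) j]. *)
Definition ts_partition (R : realType) (T : set R) (a b : R) : set (seq R) :=
  [set s | itv_partition a b s /\ [set` a :: s] `<=` ts_itv T a b].

Definition upper_sum (bx : box) (R : realType) (T : set R) (a b : R)
    (f g : R -> R) (s : seq R) : R :=
  let t := nth b (a :: s) in
  \sum_(0 <= j < size s)
    sup (f @` box_itv bx T (t j) (t j.+1)) * (g (t j.+1) - g (t j)).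

Definition lower_sum (bx : box) (R : realType) (T : set R) (a b : R)
    (f g : R -> R) (s : seq R) : R :=
  let t := nth b (a :: s) in
  \sum_(0 <= j < size s)
    inf (f @` box_itv bx T (t j) (t j.+1)) * (g (t j.+1) - g (t j)).

Definition upper_integral (bx : box) (R : realType) (T : set R) (a b : R)
    (f g : R -> R) : R :=
  inf (upper_sum bx T a b f g @` ts_partition T a b).

Definition lower_integral (bx : box) (R : realType) (T : set R) (a b : R)
    (f g : R -> R) : R :=
  sup (lower_sum bx T a b f g @` ts_partition T a b).

(* Functions on [[a, b]_T] are represented by total functions [R -> R]; their
   values outside [[a, b]_T] are never used. Boundedness makes every [sup] and
   [inf] above a genuine one when [g] is increasing. *)
Definition RS_integrable (bx : box) (R : realType) (T : set R) (a b : R)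
    (g : R -> R) : set (R -> R) :=
  [set f | [bounded f x | x in ts_itv T a b] /\
           lower_integral bx T a b f g = upper_integral bx T a b f g].

(* Main.v *)
Require Import Defs.
From HB Require Import structures.
From mathcomp Require Import all_boot all_order all_algebra.
From mathcomp Require Import all_classical all_reals all_analysis.
From mathcomp Require Import lra.
Import Order.TTheory GRing.Theory Num.Theory.
Import numFieldNormedType.Exports.

Local Open Scope classical_set_scope.
Local Open Scope ring_scope.

(** Two facts carry the criterion.  Passing to a finer partition lowers upper
    sums and raises lower sums, and any two partitions have a common
    refinement; hence every lower sum is at most every upper sum
    ([lower_sum_le_upper_sum]), and the lower integral is at most the upper
    one.  If the integrals agree, an upper sum and a lower sum that are both
    within [eps / 2] of the common value yield, on a common refinement, a
    single partition with gap below [eps].  Conversely the difference of the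
    integrals is squeezed between [0] and the gap of any partition.

    What is particular to a time scale is that refinement only works because
    splitting a cell at a point [c] of [T] produces two cells contained in the
    original one.  For the Delta cell [[u, rho v]] this is
    [rho c <= c <= rho v]: the point [c] itself competes in the supremum that
    defines [rho v]; the Nabla case is symmetric
    ([box_itv_subl], [box_itv_subr]).

    Refinement is carried out for an abstract weight [w u v] of the cell between
    [u] and [v] that does not increase under splitting
    ([common_refinement]).  Upper sums are of this form, and so are the
    opposites of lower sums, since these are the upper sums of [- f]
    ([lower_sumE]). *)

(** * Cells of a time scale *)

Section cells.
Context {R : realType}.
Implicit Types (T : set R) (u v c : R) (bx : box).

Lemma bwd_jump_bounds T u v : T u -> u < v -> u <= bwd_jump T v <= v.
Proof.
move=> Tu uv; have ubS : ubound [set s | T s /\ s < v] v.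
  by move=> s [_ /ltW].
have S0 : [set s | T s /\ s < v] !=set0 by exists u.
rewrite /bwd_jump; case: pselect => [?/=|//]; apply/andP; split.
- by apply: ub_le_sup => //; exists v.
- exact: ge_sup.
Qed.

Lemma fwd_jump_bounds T u v : T v -> u < v -> u <= fwd_jump T u <= v.
Proof.
move=> Tv uv; have lbS : lbound [set s | T s /\ u < s] u.
  by move=> s [_ /ltW].
have S0 : [set s | T s /\ u < s] !=set0 by exists v.
rewrite /fwd_jump; case: pselect => [?/=|//]; apply/andP; split.
- exact: lb_le_inf.
- by apply: ge_inf => //; exists u.
Qed.

Lemma ts_itvS T (u v u' v' : R) : u' <= u -> v <= v' ->
  ts_itv T u v `<=` ts_itv T u' v'.
Proof. by move=> uu vv x [xuv Tx]; split=> //; exact: subset_itvScc xuv. Qed.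

(** The Delta cell [[u, rho v]] contains [u], and the Nabla cell [[sigma u, v]]
    contains [v]. *)
Lemma box_itv_neq0 bx T u v : T u -> T v -> u < v -> box_itv bx T u v !=set0.
Proof.
move=> Tu Tv uv; case: bx => /=.
- have /andP[? _] := bwd_jump_bounds _ _ _ Tu uv.
  by exists u; split=> //=; rewrite in_itv /= lexx.
- have /andP[_ ?] := fwd_jump_bounds _ _ _ Tv uv.
  by exists v; split=> //=; rewrite in_itv /= lexx andbT.
Qed.

Lemma box_itv_sub bx T u v : T u -> T v -> u < v ->
  box_itv bx T u v `<=` ts_itv T u v.
Proof.
move=> Tu Tv uv; case: bx; apply: ts_itvS => //.
- by have /andP[] := bwd_jump_bounds _ _ _ Tu uv.
- by have /andP[] := fwd_jump_bounds _ _ _ Tv uv.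
Qed.

(** In the Delta case, [rho c <= c <= rho v]. *)
Lemma box_itv_subl bx T u c v : T u -> T c -> u < c -> c < v ->
  box_itv bx T u c `<=` box_itv bx T u v.
Proof.
move=> Tu Tc uc cv; case: bx; apply: ts_itvS => //; last exact: ltW.
have /andP[_ rc] := bwd_jump_bounds _ _ _ Tu uc.
by have /andP[cr _] := bwd_jump_bounds _ _ _ Tc cv; exact: le_trans cr.
Qed.

(** In the Nabla case, [sigma u <= c <= sigma c]. *)
Lemma box_itv_subr bx T u c v : T c -> T v -> u < c -> c < v ->
  box_itv bx T c v `<=` box_itv bx T u v.
Proof.
move=> Tc Tv uc cv; case: bx; apply: ts_itvS => //; first exact: ltW.
have /andP[_ sc] := fwd_jump_bounds _ _ _ Tc uc.
by have /andP[cs _] := fwd_jump_bounds _ _ _ Tv cv; exact: le_trans cs.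
Qed.

End cells.

(** * Common refinement for sums over cells *)

Section refinement.
Context {R : realType}.
Implicit Types (D : set R) (w : R -> R -> R) (a b : R) (s : seq R).

Definition cell_sum w b a s : R :=
  \sum_(0 <= j < size s) w (nth b (a :: s) j) (nth b (a :: s) j.+1).

(** Partitions of [[a, b]] with points in a fixed set [D]; unlike
    [ts_partition], the set of allowed points does not shrink with the
    interval, so that the tail of a partition is again a partition. *)
Definition partition_in D a b s : Prop :=
  itv_partition a b s /\ [set` a :: s] `<=` D.

Definition splits_down D w : Prop :=
  forall u c v, D u -> D c -> D v -> u < c -> c < v ->
    w u c + w c v <= w u v.

Lemma cell_sum_cons w b a u s :
  cell_sum w b a (u :: s) = w a u + cell_sum w b u s.
Proof. by rewrite /cell_sum /= big_nat_recl. Qed.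

Lemma partition_in_cons D a b u s :
  partition_in D a b (u :: s) <-> [/\ D a, a < u & partition_in D u b s].
Proof.
rewrite /partition_in /itv_partition /=; split.
- move=> [[/andP[au pu] lb] sD]; split=> //; first by apply: sD; rewrite /= mem_head.
  by split=> // x /= xs; apply: sD; rewrite /= in_cons xs orbT.
- move=> [Da au [[-> ->] sD]]; rewrite au; split=> // x /=.
  by rewrite in_cons => /predU1P[->//|]; exact: sD.
Qed.

Lemma partition_in_head D a b s : partition_in D a b s -> D a.
Proof. by move=> [_]; apply; rewrite /= mem_head. Qed.

Lemma le_cell_sum D w1 w2 a b s :
  (forall u v, D u -> D v -> u < v -> w1 u v <= w2 u v) ->
  partition_in D a b s -> cell_sum w1 b a s <= cell_sum w2 b a s.
Proof.
move=> w12; elim: s a => [|u s IH] a; first by rewrite /cell_sum !big_geq.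
move=> /partition_in_cons[Da au us]; rewrite !cell_sum_cons lerD ?IH// w12//.
exact: partition_in_head us.
Qed.

(** Merging [s1] and [s2] from the left: the smaller of the two first points
    becomes the first point of the refinement, and it cuts the first cell of
    the other partition, whose remaining part stays in the recursive call.
    Two unrelated weights are treated at once because the refinement has to
    serve upper and lower sums together. *)
Lemma common_refinement D w1 w2 a b s1 s2 :
  splits_down D w1 -> splits_down D w2 ->
  partition_in D a b s1 -> partition_in D a b s2 ->
  exists r, [/\ partition_in D a b r,
    cell_sum w1 b a r <= cell_sum w1 b a s1 &
    cell_sum w2 b a r <= cell_sum w2 b a s2].
Proof.
have [n] := ubnP (size s1 + size s2)%N.
elim: n => // n IH in w1 w2 a s1 s2 *; rewrite ltnS.
case: s1 => [|u s1] szn w1D w2D p1 p2.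
  have ab : a = b by case: p1 => [/itv_partition_nil].
  exists [::]; split=> //; subst a.
  by case: p2 => [/itv_partitionxx ->].
case: s2 => [|v s2] in szn p2 *.
  have ab : a = b by case: p2 => [/itv_partition_nil].
  by subst a; case: p1 => [/itv_partitionxx].
wlog uv : w1 w2 w1D w2D u v s1 s2 szn p1 p2 / u <= v.
  move=> WL; have [|/ltW vu] := leP u v; first exact: WL p1 p2.
  rewrite addnC in szn.
  by have [r []] := WL w2 w1 w2D w1D _ _ _ _ szn p2 p1 vu; exists r.
have [Da au q1] := (partition_in_cons D a b u s1).1 p1.
have [_ av q2] := (partition_in_cons D a b v s2).1 p2.
have [uv'|uv'] := eqVneq u v.
  subst v; have sz : (size s1 + size s2 < n)%N.
    by apply: leq_trans szn; rewrite /= addSn addnS ltnS leqnSn.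
  have [r [pr r1 r2]] := IH w1 w2 u s1 s2 sz w1D w2D q1 q2.
  exists (u :: r); rewrite !cell_sum_cons !lerD2l; split=> //.
  exact/partition_in_cons.
have {}uv : u < v by rewrite lt_neqAle uv'.
have q2' : partition_in D u b (v :: s2).
  by apply/partition_in_cons; split=> //; exact: partition_in_head q1.
have [r [pr r1 r2]] := IH w1 w2 u s1 (v :: s2) szn w1D w2D q1 q2'.
exists (u :: r); rewrite !cell_sum_cons lerD2l; split=> //.
  exact/partition_in_cons.
have Du := partition_in_head _ _ _ _ q1.
have Dv := partition_in_head _ _ _ _ q2.
have := w2D _ _ _ Da Du Dv au uv; move: r2; rewrite cell_sum_cons; lra.
Qed.

End refinement.

(** * Upper and lower sums *)

Section darboux_sums.
Context {R : realType} (bx : box) (T : set R) (a b : R) (g : R -> R).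
Context (g_incr : {in ts_itv T a b &, {homo g : x y / x < y}}).
Implicit Types f : R -> R.

Let D := ts_itv T a b.

Lemma box_itv_in u v : D u -> D v -> u < v -> box_itv bx T u v `<=` D.
Proof.
move=> [/= + Tu] [/= + Tv] uv; rewrite !in_itv /= => /andP[au _] /andP[_ vb].
by apply: subset_trans (box_itv_sub _ _ _ _ Tu Tv uv) _; exact: ts_itvS.
Qed.

(** Needed wherever a supremum over a cell is used, because [sup] has the
    default value [0] on sets that are empty or unbounded above. *)
Lemma has_sup_cell f u v : has_ubound (f @` D) -> D u -> D v -> u < v ->
  has_sup (f @` box_itv bx T u v).
Proof.
move=> [M fM] Du Dv uv; split.
  by apply: image_nonempty; apply: box_itv_neq0 => //; [case: Du | case: Dv].
exists M => _ [x xuv <-]; apply: fM; exists x => //.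
exact: box_itv_in xuv.
Qed.

Let upper_cell f u v := sup (f @` box_itv bx T u v) * (g v - g u).

(** Both parts of a split cell lie in the original cell, so the supremum over
    each is at most the original one, and the increments of [g] add up; their
    being nonnegative is where monotonicity of [g] enters. *)
Lemma upper_cell_splits_down f : has_ubound (f @` D) ->
  splits_down D (upper_cell f).
Proof.
move=> fM u c v Du Dc Dv uc cv; have uv := lt_trans uc cv.
have [Tu Tc Tv] : [/\ T u, T c & T v] by split; [case: Du|case: Dc|case: Dv].
have gD x y : D x -> D y -> x < y -> 0 <= g y - g x.
  by move=> /mem_set Dx /mem_set Dy xy; rewrite subr_ge0 ltW// g_incr.
have supS x y : D x -> D y -> x < y ->
    box_itv bx T x y `<=` box_itv bx T u v ->
    sup (f @` box_itv bx T x y) <= sup (f @` box_itv bx T u v).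
  move=> Dx Dy xy xyuv; apply: ge_sup.
    by have [] := has_sup_cell _ _ _ fM Dx Dy xy.
  move=> _ [z zxy <-]; apply: sup_upper_bound; first exact: has_sup_cell.
  by exists z => //; exact: xyuv.
have -> : upper_cell f u v =
    sup (f @` box_itv bx T u v) * (g c - g u) +
    sup (f @` box_itv bx T u v) * (g v - g c).
  by rewrite -mulrDr [X in _ * X]addrC subrKA.
apply: lerD; apply: ler_wpM2r; rewrite ?gD//; apply: supS => //.
- exact: box_itv_subl.
- exact: box_itv_subr.
Qed.

(** Reduces the behaviour of lower sums under refinement to that of upper
    sums. *)
Lemma lower_sumE f s :
  lower_sum bx T a b f g s = - upper_sum bx T a b (fun x => - f x) g s.
Proof.
rewrite /lower_sum /upper_sum -sumrN; apply: eq_bigr => j _.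
by rewrite /inf image_comp mulNr.
Qed.

Context (f : R -> R) (f_bnd : [bounded f x | x in D]).

Let U s := upper_sum bx T a b f g s.
Let L s := lower_sum bx T a b f g s.

Lemma has_ubound_bounded : has_ubound (f @` D).
Proof.
have [M _ fM] := pinfty_ex_gt0 f_bnd.
by exists M => _ [x Dx <-]; exact: le_trans (ler_norm _) (fM x Dx).
Qed.

Lemma has_ubound_boundedN : has_ubound ((fun x => - f x) @` D).
Proof.
have [M _ fM] := pinfty_ex_gt0 f_bnd.
exists M => _ [x Dx <-]; apply: le_trans (fM x Dx).
by rewrite -normrN ler_norm.
Qed.

Lemma lower_sum_le_upper_sum_same s : ts_partition T a b s -> L s <= U s.
Proof.
apply: (@le_cell_sum _ D (fun u v => inf (f @` box_itv bx T u v) * (g v - g u))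
  (upper_cell f)) => u v Du Dv uv.
apply: ler_wpM2r.
  by rewrite subr_ge0 ltW// g_incr// mem_set.
(* Any point of the cell separates its infimum from its supremum. *)
have [[y [x xuv _]] _] := has_sup_cell _ _ _ has_ubound_bounded Du Dv uv.
apply: (@le_trans _ _ (f x)).
  apply: ge_inf; last by exists x.
  have [_ ubN] := has_sup_cell _ _ _ has_ubound_boundedN Du Dv uv.
  by apply/has_lb_ubN; rewrite image_comp.
apply: sup_upper_bound; first exact: has_sup_cell has_ubound_bounded _ _ _.
by exists x.
Qed.

Lemma common_refinement_sums s1 s2 :
  ts_partition T a b s1 -> ts_partition T a b s2 ->
  exists r, [/\ ts_partition T a b r, U r <= U s1 & L s2 <= L r].
Proof.
move=> p1 p2.
have [r [pr Ur Lr]] := common_refinement _ _ _ _ _ _ _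
  (upper_cell_splits_down _ has_ubound_bounded)
  (upper_cell_splits_down _ has_ubound_boundedN) p1 p2.
by exists r; split=> //; rewrite /L !lower_sumE lerN2.
Qed.

Lemma lower_sum_le_upper_sum s1 s2 :
  ts_partition T a b s1 -> ts_partition T a b s2 -> L s1 <= U s2.
Proof.
move=> p1 p2; have [r [pr Ur Lr]] := common_refinement_sums _ _ p2 p1.
exact: le_trans Lr (le_trans (lower_sum_le_upper_sum_same _ pr) Ur).
Qed.

End darboux_sums.

(** * The criterion *)

Theorem theorem2p5 (R : realType) (T : set R) (a b : R) (bx : box)
    (f g : R -> R) (hT : time_scale T) (Ta : T a) (Tb : T b) (ab : a < b)
    (g_incr : {in ts_itv T a b &, {homo g : x y / x < y}})
    (f_bnd : [bounded f x | x in ts_itv T a b]) :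
  RS_integrable bx T a b g f <->
  (forall eps : R, 0 < eps ->
     exists2 P, ts_partition T a b P &
       upper_sum bx T a b f g P - lower_sum bx T a b f g P < eps).
Proof.
(* The trivial partition makes the sets of upper and lower sums nonempty; its
   lower sum bounds all upper sums from below, its upper sum all lower sums
   from above. *)
have p0 : ts_partition T a b [:: b].
  split; first exact: itv_partition1.
  move=> x /=; rewrite !inE => /orP[] /eqP ->; split=> //=.
    by rewrite in_itv /= lexx ltW.
  by rewrite in_itv /= lexx ltW.
have LU := lower_sum_le_upper_sum bx T a b g g_incr f f_bnd.
pose Us := upper_sum bx T a b f g @` ts_partition T a b.
pose Ls := lower_sum bx T a b f g @` ts_partition T a b.
have infU : has_inf Us.
  split; first by exists (upper_sum bx T a b f g [:: b]); exists [:: b].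
  exists (lower_sum bx T a b f g [:: b]) => _ [s ps <-]; exact: LU.
have supL : has_sup Ls.
  split; first by exists (lower_sum bx T a b f g [:: b]); exists [:: b].
  exists (upper_sum bx T a b f g [:: b]) => _ [s ps <-]; exact: LU.
split=> [[_ intLU] eps eps0|gap].
- have e2 : 0 < eps / 2 by rewrite divr_gt0.
  have [_ [s1 p1 <-] Us1] := inf_adherent e2 infU.
  have [_ [s2 p2 <-] Ls2] := sup_adherent e2 supL.
  have [r [pr Ur Lr]] :=
    common_refinement_sums bx T a b g g_incr f f_bnd _ _ p1 p2.
  exists r => //.
  have : sup Ls = inf Us by [].
  move: Us1 Ls2 Ur Lr; lra.
- split=> //; apply/eqP; rewrite eq_le; apply/andP; split.
    apply: ge_sup => [|_ [s1 p1 <-]]; first by case: supL.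
    apply: lb_le_inf => [|_ [s2 p2 <-]]; first by case: infU.
    exact: LU.
  apply/ler_addgt0Pl => eps /gap[s ps].
  have Us_inf : inf Us <= upper_sum bx T a b f g s.
    by apply: ge_inf; [case: infU | exists s].
  have Ls_sup : lower_sum bx T a b f g s <= sup Ls.
    by apply: sup_upper_bound => //; exists s.
  rewrite /upper_integral /lower_integral -/Us -/Ls; lra.
Qed.
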